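(* Let $k\ge 0$ be an integer and $n=48k+22$; all arithmetic is modulo $n$. Define $c_1(r)=r$ for $0\le r\le n-1$. Define $c_2,c_3:\{0,\dots,n-1\}\to\mathbb{Z}_n$ by: for $0\le i\le 12k+5$, $c_2(2i)=30k+13+i(12k+6)$ and $c_3(2i)=30k+14+i(12k+7)$; for $0\le i\le 12k+4$, $c_2(2i+1)=12k+5+i(12k+6)$ and $c_3(2i+1)=24k+12+i(12k+7)$; and for $0\le r\le 24k+10$ and $\alpha=2,3$, $c_\alpha(n-1-r)=n-1-c_\alpha(r)$. For $\alpha=1,2,3$ let ${\cal L}_\alpha=[l_\alpha(r,j)]$ be the $n\times n$ array with $l_\alpha(r,j)\equiv c_\alpha(r)+j\pmod n$, $0\le r,j\le n-1$. Then ${\cal L}_1,{\cal L}_2,{\cal L}_3$ are three (cyclic) mutually nearly orthogonal Latin squares of order $n$, i.e. they are Latin squares and each pair of them is nearly orthogonal.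
   Context: A Latin square of order $n$ is an $n\times n$ array in which each row and each column contains each of the symbols $0,\dots,n-1$ exactly once. For Latin squares $L=[l(i,j)]$ and $M=[m(i,j)]$ of even order $n$ on symbols $\{0,\dots,n-1\}$, their superimposition is the $n\times n$ array $A=[(l(i,j),m(i,j))]$. $L$ and $M$ are nearly orthogonal if in $A$ every ordered pair $(x,y)$ with $0\le x,y\le n-1$, $x\ne y$, occurs at least once, and each ordered pair $(x,x+n/2)$ (second coordinate taken modulo $n$) occurs exactly twice. A set of Latin squares is mutually nearly orthogonal if every two of them are nearly orthogonal. *)

(* Defs.v *)
From mathcomp Require Import all_boot all_algebra.

Set Implicit Arguments.
Unset Strict Implicit.
Unset Printing Implicit Defensive.

Section Squares.
Variable n : nat.

(* (j + m) modulo n, as an element of {0, ..., n-1}; the existence of j is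
   what makes n positive. *)
Definition ord_shift (j : 'I_n) (m : nat) : 'I_n :=
  Ordinal (ltn_pmod (m + j) (leq_ltn_trans (leq0n j) (ltn_ord j))).

Definition latin_square (L : 'M['I_n]_n) : Prop :=
  (forall i s : 'I_n, #|[set j | L i j == s]| = 1) /\
  (forall j s : 'I_n, #|[set i | L i j == s]| = 1).

Definition superimposition (L M : 'M['I_n]_n) : 'M['I_n * 'I_n]_n :=
  (\matrix_(i, j) (L i j, M i j))%R.

Definition occurrences (A : 'M['I_n * 'I_n]_n) (p : 'I_n * 'I_n) : nat :=
  #|[set ij : 'I_n * 'I_n | A ij.1 ij.2 == p]|.

Definition nearly_orthogonal (L M : 'M['I_n]_n) : Prop :=
  [/\ ~~ odd n,
      forall x y : 'I_n, x != y -> 1 <= occurrences (superimposition L M) (x, y)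
    & forall x : 'I_n,
        occurrences (superimposition L M) (x, ord_shift x n./2) = 2].

Definition mutually_nearly_orthogonal (S : {set 'M['I_n]_n}) : Prop :=
  (forall L, L \in S -> latin_square L) /\
  (forall L M, L \in S -> M \in S -> L != M -> nearly_orthogonal L M).

Definition cyclic_array (c : nat -> nat) : 'M['I_n]_n :=
  (\matrix_(r, j) ord_shift j (c r))%R.

(* The map c : {0, ..., n-1} -> {0, ..., n-1} given modulo n by h on the first
   half and by c(n-1-r) = n-1-c(r) on the second half.  Values are reduced
   modulo n, so no subtraction is truncated for r < n. *)
Definition antisymmetric_extension (h : nat -> nat) (r : nat) : nat :=
  if r < n./2 then h r %% n else n - 1 - h (n - 1 - r) %% n.

End Squares.

Arguments cyclic_array : clear implicits.

Definition sq_order (k : nat) : nat := 48 * k + 22.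

Definition c1 (k r : nat) : nat := r.

(* r./2 is the i for which r = 2i or r = 2i+1. *)
Definition c2 (k : nat) : nat -> nat :=
  antisymmetric_extension (sq_order k) (fun r =>
    if odd r then 12 * k + 5 + r./2 * (12 * k + 6)
    else 30 * k + 13 + r./2 * (12 * k + 6)).

Definition c3 (k : nat) : nat -> nat :=
  antisymmetric_extension (sq_order k) (fun r =>
    if odd r then 24 * k + 12 + r./2 * (12 * k + 7)
    else 30 * k + 14 + r./2 * (12 * k + 7)).

(* Main.v *)
(* Write n = 2h with h = 24k+11.  The pair (x, y) occurs in the superimposition
   of the cyclic arrays of c and d as often as d(r) - c(r) takes the value
   y - x modulo n, so everything reduces to the values of c_2, c_3 and of the
   differences of the c_i.  As 4(12k+6) = n+2, multiplying by 4 linearises the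
   columns modulo h: for r < h,
     4 c_2(r) = r - 3 and c_2(r) is odd,
     4 c_3(r) = 3r + 1 and c_3(r) has the parity of floor(r/2).
   Hence each f among c_2, c_3, c_2 - c_1, c_3 - c_1, c_3 - c_2 is a bijection
   modulo h on the first half.  Given z, let f(r) = z and f(q) = e - z modulo h,
   where the second half carries the values e - f(r), with e = -1 for columns
   and e = 0 for differences; r + q is then constant modulo h, and since
   h = 3 modulo 8 the values f(r) and e - f(q) have distinct parities (apart
   from the case z = h of a difference), so one of them is z modulo n. *)

Require Import Defs.
From mathcomp Require Import all_boot all_order all_algebra.
From mathcomp Require Import zify ring.

Set Implicit Arguments.
Unset Strict Implicit.
Unset Printing Implicit Defensive.

Import GRing.Theory.

(** * Solving congruences modulo an odd [h] and lifting them to [2h] *)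

Section Congruences.
Local Open Scope ring_scope.

Lemma linear_congruence (h : nat) (a c : int) :
  (0 < h)%N -> coprimez a h -> exists2 r : nat, (r < h)%N & (h %| a * r%:Z - c)%Z.
Proof.
move=> h_gt0; rewrite coprimez_sym => /coprimezP[[u v] /= uv].
have h0 : h%:Z != 0 by lia.
have m0 := modz_ge0 (v * c) h0.
have mlt : (v * c %% h < h)%Z by rewrite ltz_pmod.
(* In the Bezout relation [v] is an inverse of [a] modulo [h], so [v * c], reduced modulo [h], is
   the solution. *)
exists `|(v * c %% h)%Z|%N; first by lia.
rewrite gez0_abs // /modz.
apply/dvdzP; exists (- (a * ((v * c) %/ h)%Z) - u * c).
by rewrite -[X in _ - X = _]mul1r -uv; ring.
Qed.

(** Adding the linear congruences for [f r = z] and [f q = e - z] gives [a * (r + q + s) = 0] modulo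
    [h]; this is where [2 * b = a * s + 4 * e] comes from. If [f r - z] and [f r + f q - e] are both
    odd, then [f q + z - e] is even, and the reflected value at [q] takes over. *)
Lemma reflected_values (h : nat) (f : nat -> int) (a b e s z : int) :
  odd h -> coprimez a h -> 2 * b = a * s + 4 * e ->
  (forall r, (r < h)%N -> (h %| 4 * f r - (a * r%:Z + b))%Z) ->
  (forall r q, (r < h)%N -> (q < h)%N -> (h %| r%:Z + q%:Z + s)%Z ->
     (h %| f r - z)%Z -> (h %| f q + z - e)%Z ->
     (2 %| f r - z)%Z \/ ~~ (2 %| f r + f q - e)%Z) ->
  exists2 r, (r < h)%N & (h.*2 %| f r - z)%Z \/ (h.*2 %| e - f r - z)%Z.
Proof.
move=> h_odd cop_ah bE f_lin f_par.
have h_gt0 : (0 < h)%N by case: h h_odd {cop_ah f_lin f_par}.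
have cop_2h : coprimez h 2 by rewrite coprimezE /= coprimen2.
have cop_4h : coprimez h 4.
  by rewrite coprimezE (_ : `|4|%N = (2 ^ 2)%N) // coprimeXr // coprimen2.
have [r r_lt r_sol] := @linear_congruence h a (4 * z - b) h_gt0 cop_ah.
have [q q_lt q_sol] := @linear_congruence h a (4 * (e - z) - b) h_gt0 cop_ah.
have dvd_r : (h %| f r - z)%Z.
  rewrite -(Gauss_dvdzr _ cop_4h).
  suff -> : 4 * (f r - z) = (4 * f r - (a * r%:Z + b)) + (a * r%:Z - (4 * z - b)).
    by rewrite rpredD ?f_lin.
  by ring.
have dvd_q : (h %| f q + z - e)%Z.
  rewrite -(Gauss_dvdzr _ cop_4h).
  suff -> : 4 * (f q + z - e) =
    (4 * f q - (a * q%:Z + b)) + (a * q%:Z - (4 * (e - z) - b)).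
    by rewrite rpredD ?f_lin.
  by ring.
have dvd_s : (h %| r%:Z + q%:Z + s)%Z.
  have asE : a * s = 2 * b - 4 * e by rewrite bE addrK.
  have cop_ha : coprimez h a by rewrite coprimez_sym.
  rewrite -(Gauss_dvdzr _ cop_ha).
  suff -> : a * (r%:Z + q%:Z + s) =
    (a * r%:Z - (4 * z - b)) + (a * q%:Z - (4 * (e - z) - b)) by rewrite rpredD.
  by rewrite mulrDr asE; ring.
have crt x : (h %| x)%Z -> (2 %| x)%Z -> (h.*2 %| x)%Z.
  by move=> hx x2; rewrite -muln2 PoszM (Gauss_dvdz _ cop_2h) hx.
case: (boolP (2 %| f r - z)%Z) => [r_par|r_par].
  by exists r => //; left; apply: crt.
have [r_par'|rq_par] := f_par r q r_lt q_lt dvd_s dvd_r dvd_q.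
  by rewrite r_par' in r_par.
exists q => //; right; rewrite -rpredN; apply: crt; last first.
  by move: r_par rq_par; clear; lia.
by have -> : - (e - f q - z) = f q + z - e by ring.
Qed.

Lemma reflected_values_neq0 (h : nat) (f : nat -> int) (a b s z : int) :
  odd h -> coprimez a h -> 2 * b = a * s ->
  (forall r, (r < h)%N -> (h %| 4 * f r - (a * r%:Z + b))%Z) ->
  (forall r q, (r < h)%N -> (q < h)%N -> (h %| r%:Z + q%:Z + s)%Z ->
     if r == q then ~~ (2 %| f r)%Z else ~~ (2 %| f r + f q)%Z) ->
  ~~ (h.*2 %| z)%Z ->
  exists2 r, (r < h)%N & (h.*2 %| f r - z)%Z \/ (h.*2 %| - f r - z)%Z.
Proof.
move=> h_odd cop_ah bE f_lin f_par z_neq0.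
have cop_2h : coprimez h 2 by rewrite coprimezE /= coprimen2.
have := @reflected_values h f a b 0 s z h_odd cop_ah.
rewrite mulr0 addr0 => /(_ bE f_lin) [r q r_lt q_lt dvd_s dvd_r dvd_q|r r_lt].
  have := f_par r q r_lt q_lt dvd_s.
  (* When [r = q], [f r] is both [z] and [-z] modulo [h], so [h] divides [z]. As [2h] does not, [z]
     is odd, like [f r]. *)
  case: eqP => [rq|_]; last by rewrite subr0; right.
  subst q => fr_odd; rewrite subr0 in dvd_q; left.
  have dvd_z : (h %| z)%Z.
    rewrite -(Gauss_dvdzr _ cop_2h).
    have -> : 2 * z = (f r + z) - (f r - z) by ring.
    by rewrite rpredB.
  suff : ~~ (2 %| z)%Z by move: fr_odd; clear; lia.
  by move: z_neq0; rewrite -muln2 PoszM (Gauss_dvdz _ cop_2h) dvd_z.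
by rewrite sub0r => ?; exists r.
Qed.

End Congruences.

(** The fibre sizes also sum to [#|T|], so no lower bound can be strict. This turns surjectivity
    statements into exact counts. *)
Lemma card_fibers (T U : finType) (f : T -> U) (m : U -> nat) :
  (forall u, m u <= #|[set t | f t == u]|) -> \sum_u m u = #|T| ->
  forall u, #|[set t | f t == u]| = m u.
Proof.
move=> m_le m_sum u.
have fib_sum : \sum_v #|[set t | f t == v]| = #|T|.
  rewrite -sum1_card (partition_big f predT) //=.
  by apply: eq_bigr => v _; rewrite -sum1dep_card.
have [_] := leqif_sum (fun v (_ : predT v) => leqif_eq (m_le v)).
by rewrite fib_sum m_sum eqxx => /esym/forallP/(_ u)/eqP.
Qed.

(** * Cyclic arrays in terms of their first columns *)

Section CyclicArrays.
Local Open Scope ring_scope.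

Lemma eq_ord_dvdz (n : nat) (x y : 'I_n) : (x == y) = (n %| x%:Z - y%:Z)%Z.
Proof. by rewrite -eqz_mod_dvd !modz_nat eqz_nat !modn_small. Qed.

Lemma ord_shiftE (n : nat) (j x : 'I_n) (m : nat) :
  (ord_shift j m == x) = (n %| m%:Z + j%:Z - x%:Z)%Z.
Proof. by rewrite -PoszD -eqz_mod_dvd !modz_nat eqz_nat (modn_small (ltn_ord x)). Qed.

Lemma ord_shift_surj (n : nat) (j : 'I_n) (z : int) :
  exists x : 'I_n, (n %| z + j%:Z - x%:Z)%Z.
Proof.
have n_neq0 : n%:Z != 0 by have := ltn_ord j; case: n j.
have m_ge0 := modz_ge0 z n_neq0.
exists (ord_shift j `|(z %% n)%Z|%N); set x := ord_shift _ _.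
have dvd_x : (n %| (z %% n)%Z + j%:Z - x%:Z)%Z.
  by have := eqxx x; rewrite {1}/x ord_shiftE gez0_abs.
rewrite -(rpredBl _ dvd_x).
rewrite (_ : _ - (_ - _) = (z %% n)%Z - z); last by ring.
by rewrite -eqz_mod_dvd modz_mod.
Qed.

Lemma latin_cyclic_array (n : nat) (c : nat -> nat) :
  (forall z : int, exists2 r, (r < n)%N & (n %| (c r)%:Z - z)%Z) ->
  latin_square (cyclic_array n c).
Proof.
move=> c_surj.
have latin_line (f : 'I_n -> 'I_n) (s : 'I_n) :
    (forall u, exists t, f t = u) -> #|[set t | f t == s]| = 1%N.
  move=> f_surj; apply: (@card_fibers _ _ f (fun=> 1%N)); last by rewrite sum1_card.
  by move=> u; have [t ft] := f_surj u; apply/card_gt0P; exists t; rewrite inE ft.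
split=> [i s|j s].
  (* Each row is a translation of the residues, whatever [c] is; only the columns need [c_surj]. *)
  rewrite -(latin_line (fun j => ord_shift j (c i)) s); last first.
    move=> u; have [x dvd_x] := @ord_shift_surj n u (- (c i)%:Z).
    exists x; apply/eqP; rewrite ord_shiftE -rpredN.
    by rewrite (_ : - (_ + _ - _) = - (c i)%:Z + u%:Z - x%:Z) //; ring.
  by apply: eq_card => j; rewrite !inE mxE.
rewrite -(latin_line (fun i => ord_shift j (c i)) s); last first.
  move=> u; have [r r_lt dvd_r] := c_surj (u%:Z - j%:Z).
  exists (Ordinal r_lt); apply/eqP; rewrite ord_shiftE /=.
  by rewrite (_ : _ + _ - _ = (c r)%:Z - (u%:Z - j%:Z)) //; ring.
by apply: eq_card => i; rewrite !inE mxE.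
Qed.

Lemma occurrences_cyclic_array (n : nat) (c d : nat -> nat) (x y : 'I_n) :
  occurrences (superimposition (cyclic_array n c) (cyclic_array n d)) (x, y) =
  #|[set r : 'I_n | (n %| (d r)%:Z - (c r)%:Z - (y%:Z - x%:Z))%Z]|.
Proof.
rewrite /occurrences.
set S := [set _ | _]; set T := [set _ | _].
have S_E r j : ((r, j) \in S) =
    (n %| (c r)%:Z + j%:Z - x%:Z)%Z && (n %| (d r)%:Z + j%:Z - y%:Z)%Z.
  by rewrite inE !mxE xpair_eqE !ord_shiftE.
(* In row [r] the first symbol [x] determines the column, so cells can be counted by their rows. *)
have fst_inj : {in S &, injective fst}.
  move=> [r j] [r' j'] + + /= rr; rewrite -rr !S_E => /andP[dvd_j _] /andP[dvd_j' _].
  congr (_, _); apply/eqP; rewrite eq_ord_dvdz.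
  have -> : j%:Z - j'%:Z = ((c r)%:Z + j%:Z - x%:Z) - ((c r)%:Z + j'%:Z - x%:Z) by ring.
  by rewrite rpredB.
rewrite -(card_in_imset fst_inj); apply: eq_card => r.
apply/imsetP/idP => [[[r' j] rj_S /= ->]|].
  move: rj_S; rewrite S_E inE => /andP[dvd_x dvd_y].
  have -> : (d r')%:Z - (c r')%:Z - (y%:Z - x%:Z) =
    ((d r')%:Z + j%:Z - y%:Z) - ((c r')%:Z + j%:Z - x%:Z) by ring.
  by rewrite rpredB.
rewrite inE => dvd_r.
have [j dvd_j] := @ord_shift_surj n x (- (c r)%:Z).
exists (r, j) => //; rewrite S_E.
have dvd_x : (n %| (c r)%:Z + j%:Z - x%:Z)%Z.
  by rewrite -rpredN (_ : - (_ + _ - _) = - (c r)%:Z + x%:Z - j%:Z) //; ring.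
rewrite dvd_x /= (_ : _ - y%:Z = ((d r)%:Z - (c r)%:Z - (y%:Z - x%:Z)) +
  ((c r)%:Z + j%:Z - x%:Z)); last by ring.
by rewrite rpredD.
Qed.

Lemma nearly_orthogonal_cyclic_array (n : nat) (c d : nat -> nat) :
  ~~ odd n ->
  (forall z : int, ~~ (n %| z)%Z ->
     exists2 r, (r < n)%N & (n %| (d r)%:Z - (c r)%:Z - z)%Z) ->
  (exists r q, [/\ (r < n)%N, (q < n)%N, r != q,
     (n %| (d r)%:Z - (c r)%:Z - n./2%:Z)%Z & (n %| (d q)%:Z - (c q)%:Z - n./2%:Z)%Z]) ->
  nearly_orthogonal (cyclic_array n c) (cyclic_array n d).
Proof.
move=> n_even diff_surj [r [q [r_lt q_lt rq dvd_r dvd_q]]].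
have n_gt0 : (0 < n)%N by case: n r_lt {n_even diff_surj q_lt dvd_r dvd_q}.
have occ_gt0 (x y : 'I_n) : x != y ->
    (0 < occurrences (superimposition (cyclic_array n c) (cyclic_array n d)) (x, y))%N.
  move=> xy; rewrite occurrences_cyclic_array.
  have [|t t_lt dvd_t] := diff_surj (y%:Z - x%:Z).
    by rewrite -eq_ord_dvdz eq_sym.
  by apply/card_gt0P; exists (Ordinal t_lt); rewrite inE.
split=> // x.
(* [f t] is the symbol paired with [x] in row [t], so occurrences of [(x, y)] are the fibre of [f]
   over [y]. *)
pose f t := xchoose (@ord_shift_surj n x ((d t)%:Z - (c t)%:Z)).
have fE (t y : 'I_n) : (f t == y) = (n %| (d t)%:Z - (c t)%:Z - (y%:Z - x%:Z))%Z.
  have dvd_ft : (n %| (d t)%:Z - (c t)%:Z + x%:Z - (f t)%:Z)%Z.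
    exact: (xchooseP (@ord_shift_surj n x ((d t)%:Z - (c t)%:Z))).
  rewrite eq_ord_dvdz -(rpredDl ((f t)%:Z - y%:Z) dvd_ft).
  by rewrite (_ : _ + (_ - _) = (d t)%:Z - (c t)%:Z - (y%:Z - x%:Z)) //; ring.
have occE y : occurrences (superimposition (cyclic_array n c) (cyclic_array n d)) (x, y) =
    #|[set t : 'I_n | f t == y]|.
  by rewrite occurrences_cyclic_array; apply: eq_card => t; rewrite !inE fE.
(* These multiplicities sum to n, so the lower bounds on the fibres are sharp. *)
pose m y := ((y != x) + (y == ord_shift x n./2))%N.
have half_neq : ord_shift x n./2 != x.
  by rewrite ord_shiftE addrK dvdzE /= gtnNdvd //; move: n_gt0 n_even; clear; lia.
rewrite occE (@card_fibers _ _ (fun t : 'I_n => f t) m) /m ?half_neq ?eqxx //.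
  move=> y; have [->|y_neq] := eqVneq y (ord_shift x n./2).
    rewrite half_neq -[(_ + _)%N]/2%N.
    have card2 : #|[set Ordinal r_lt; Ordinal q_lt]| = 2%N by rewrite cards2 rq.
    rewrite -card2; apply/subset_leq_card/subsetP => t; rewrite !inE => t_rq.
    rewrite fE.
    have dvd_half := eqxx (ord_shift x n./2); rewrite {1}ord_shiftE in dvd_half.
    have dvd_t : (n %| (d t)%:Z - (c t)%:Z - n./2%:Z)%Z.
      by case/orP: t_rq => /eqP->.
    have := rpredD dvd_t dvd_half.
    set w := ord_shift x n./2.
    by rewrite (_ : _ + (_ - _) = (d t)%:Z - (c t)%:Z - (w%:Z - x%:Z)) //; ring.
  rewrite addn0; have [->|yx] := eqVneq y x => //=.
  by rewrite -occE occ_gt0 // eq_sym.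
have sum_pred (P : pred 'I_n) : (\sum_y P y = #|P|)%N.
  rewrite -sum1_card [in RHS]big_mkcond; apply: eq_bigr => y _.
  by rewrite unfold_in; case: (P y).
rewrite big_split /= (sum_pred (predC1 x)) (sum_pred (pred1 _)) cardC1 card1.
by rewrite addn1 prednK // card_ord.
Qed.

(** Swapping the arrays swaps the pairs, and for even [n] the shift by [n./2] is an involution, so
    the pairs occurring twice are preserved. *)
Lemma nearly_orthogonal_sym (n : nat) (L M : 'M['I_n]_n) :
  nearly_orthogonal L M -> nearly_orthogonal M L.
Proof.
have occC (A B : 'M['I_n]_n) x y :
    occurrences (superimposition A B) (x, y) = occurrences (superimposition B A) (y, x).
  by apply: eq_card => ij; rewrite !inE !mxE !xpair_eqE andbC.
case=> n_even occ_gt0 occ_half; split=> // [x y xy|x].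
  by rewrite occC occ_gt0 // eq_sym.
rewrite occC -[in RHS](occ_half (ord_shift x n./2)).
congr (occurrences _ (_, _)); apply/eqP; rewrite eq_sym ord_shiftE.
have := eqxx (ord_shift x n./2); rewrite {1}ord_shiftE.
set w := ord_shift x n./2 => dvd_w.
rewrite -(rpredDr _ dvd_w) (_ : _ + (_ - _) = n%:Z) ?dvdzz //.
by rewrite -[in RHS](even_halfK n_even) -addnn PoszD; ring.
Qed.

(** A square superimposed on itself shows only pairs [(x, x)], hence never [(0, 1)]. This makes the
    three squares distinct. *)
Lemma nearly_orthogonal_neq (n : nat) (L M : 'M['I_n]_n) :
  (1 < n)%N -> nearly_orthogonal L M -> L != M.
Proof.
move=> n_gt1 [_ occ_gt0 _]; apply/eqP => LM.
have /card_gt0P[ij] := occ_gt0 (Ordinal (ltnW n_gt1)) (Ordinal n_gt1) isT.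
by rewrite LM inE mxE xpair_eqE => /andP[/eqP->].
Qed.

End CyclicArrays.

(** * Criteria for antisymmetric columns, checked on the first half only *)

Section Antisymmetry.
Local Open Scope ring_scope.

Definition antisymmetric_mod (n : nat) (c : nat -> nat) : Prop :=
  forall r, (r < n)%N -> (c (n - 1 - r)%N)%:Z = n%:Z - 1 - (c r)%:Z.

Lemma antisymmetric_extensionP (h : nat) (g : nat -> nat) :
  antisymmetric_mod h.*2 (antisymmetric_extension h.*2 g).
Proof.
move=> r r_lt; rewrite /antisymmetric_extension doubleK.
have g_lt s : (g s %% h.*2 < h.*2)%N by rewrite ltn_mod; case: h r_lt.
(* Exactly one of [r] and [2h - 1 - r] is below [h], so the first and last cases are
   contradictory. *)
case: ltnP => r1; case: ltnP => r2.
- by move: r_lt r1 r2; clear; lia.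
- by move: (g_lt (h.*2 - 1 - r)%N); clear; lia.
- have -> : (h.*2 - 1 - (h.*2 - 1 - r) = r)%N by move: r_lt; clear; lia.
  by move: (g_lt r); clear; lia.
- by move: r_lt r1 r2; clear; lia.
Qed.

(** The second half carries [-1 - c r] modulo [n], so this is [reflected_values] with [e = -1];
    equal parities of [c r] and [c q] make [c r + c q + 1] odd. *)
Lemma latin_antisymmetric (n h : nat) (c : nat -> nat) (a b s : int) :
  n = h.*2 -> odd h -> antisymmetric_mod n c ->
  coprimez a h -> 2 * b = a * s - 4 ->
  (forall r, (r < h)%N -> (h %| 4 * (c r)%:Z - (a * r%:Z + b))%Z) ->
  (forall r q, (r < h)%N -> (q < h)%N -> (h %| r%:Z + q%:Z + s)%Z ->
     odd (c r) = odd (c q)) ->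
  latin_square (cyclic_array n c).
Proof.
move=> -> h_odd c_anti cop_ah bE c_lin c_par.
apply: latin_cyclic_array => z.
have bE' : 2 * b = a * s + 4 * -1 by rewrite bE; ring.
have [r q r_lt q_lt dvd_s _ _|r r_lt [] dvd_r] :=
  @reflected_values h (fun r => (c r)%:Z) a b (-1) s z h_odd cop_ah bE' c_lin.
- by right; move: (c_par r q r_lt q_lt dvd_s); clear; lia.
- by exists r => //; move: r_lt; clear; lia.
have r_lt2 : (r < h.*2)%N by move: r_lt; clear; lia.
exists (h.*2 - 1 - r)%N; first by move: r_lt2; clear; lia.
rewrite c_anti // -(rpredBr _ (dvdzz h.*2)).
by rewrite (_ : _ - _ - _ = -1 - (c r)%:Z - z) //; ring.
Qed.

(** Differences of antisymmetric columns change sign under reflection, so here [e = 0]. *)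
Lemma nearly_orthogonal_antisymmetric
    (n h : nat) (c d : nat -> nat) (a b s : int) :
  n = h.*2 -> odd h -> antisymmetric_mod n c -> antisymmetric_mod n d ->
  coprimez a h -> 2 * b = a * s ->
  (forall r, (r < h)%N -> (h %| 4 * ((d r)%:Z - (c r)%:Z) - (a * r%:Z + b))%Z) ->
  (forall r q, (r < h)%N -> (q < h)%N -> (h %| r%:Z + q%:Z + s)%Z ->
     if r == q then odd (c r) != odd (d r)
     else (odd (c r) (+) odd (d r)) != (odd (c q) (+) odd (d q))) ->
  nearly_orthogonal (cyclic_array n c) (cyclic_array n d).
Proof.
move=> -> h_odd c_anti d_anti cop_ah bE f_lin f_par.
have h_gt0 : (0 < h)%N by case: h h_odd {c_anti d_anti cop_ah f_lin f_par}.
pose f r := (d r)%:Z - (c r)%:Z.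
have hits z : ~~ (h.*2 %| z)%Z ->
    exists2 r, (r < h)%N & (h.*2 %| f r - z)%Z \/ (h.*2 %| - f r - z)%Z.
  apply: (@reflected_values_neq0 h f a b s z) => // r q r_lt q_lt dvd_s.
  move: (f_par r q r_lt q_lt dvd_s); rewrite /f; clear.
  by case: eqP => _; lia.
have lt2 r : (r < h)%N -> (r < h.*2)%N by clear; lia.
have mir_lt r : (r < h)%N -> (h.*2 - 1 - r < h.*2)%N by clear; lia.
have f_mir r : (r < h)%N -> f (h.*2 - 1 - r)%N = - f r.
  by move=> /lt2 r_lt; rewrite /f c_anti // d_anti //; ring.
apply: nearly_orthogonal_cyclic_array => [|z z_neq0|]; first by rewrite odd_double.
  have [r r_lt [] dvd_r] := hits z z_neq0; first by exists r; rewrite ?lt2.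
  exists (h.*2 - 1 - r)%N; first exact: mir_lt.
  by rewrite -/(f _) f_mir.
rewrite doubleK.
(* Since [h = -h] modulo [2h], a row with difference [h] and its mirror image are the two rows
   required. *)
have dvd_2h x : (h.*2 %| x - h%:Z)%Z -> (h.*2 %| - x - h%:Z)%Z.
  rewrite -rpredN -(rpredBr _ (dvdzz h.*2)).
  by rewrite (_ : _ - h.*2%:Z = - x - h%:Z) // -addnn PoszD; ring.
have [|r r_lt dvd_r] := hits h%:Z.
  by rewrite dvdzE /= gtnNdvd //; move: h_gt0; clear; lia.
have {}dvd_r : (h.*2 %| f r - h%:Z)%Z by case: dvd_r => // /dvd_2h; rewrite opprK.
exists r, (h.*2 - 1 - r)%N; split.
- exact: lt2.
- exact: mir_lt.
- by move: r_lt; clear; lia.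
- exact: dvd_r.
by rewrite -/(f _) f_mir //; exact: dvd_2h.
Qed.

End Antisymmetry.

(** * The columns for [n = 48k + 22] *)

Section Construction.
Local Open Scope ring_scope.
Variable k : nat.

Definition half_order : nat := (24 * k + 11)%N.

Lemma sq_orderE : sq_order k = half_order.*2.
Proof. by rewrite /sq_order /half_order; lia. Qed.

Lemma half_order_odd : odd half_order.
Proof. by rewrite /half_order; lia. Qed.

Lemma antisymmetric_c1 : antisymmetric_mod (sq_order k) (c1 k).
Proof. by move=> r; rewrite /c1; lia. Qed.

Lemma antisymmetric_c2 : antisymmetric_mod (sq_order k) (c2 k).
Proof. by rewrite /c2 sq_orderE; apply: antisymmetric_extensionP. Qed.

Lemma antisymmetric_c3 : antisymmetric_mod (sq_order k) (c3 k).
Proof. by rewrite /c3 sq_orderE; apply: antisymmetric_extensionP. Qed.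

(** Reduction modulo [2h] affects neither the residue modulo [h] nor the parity, so the unreduced
    formulas suffice. *)
Lemma antisymmetric_extension_half (g : nat -> nat) (x : int) (r : nat) :
  (r < half_order)%N -> (half_order %| 4 * (g r)%:Z - x)%Z ->
  (half_order %| 4 * (antisymmetric_extension (sq_order k) g r)%:Z - x)%Z /\
  odd (antisymmetric_extension (sq_order k) g r) = odd (g r).
Proof.
move=> r_lt dvd_g; rewrite /antisymmetric_extension sq_orderE doubleK r_lt.
rewrite odd_mod ?odd_double //; split=> //.
rewrite -(rpredBr _ dvd_g).
have := divn_eq (g r) half_order.*2.
set u := (_ %/ _)%N; set v := (_ %% _)%N => ->.
rewrite (_ : _ - _ - _ = - (8 * u%:Z) * half_order%:Z); first exact: dvdz_mull.
by rewrite -muln2 PoszD !PoszM; ring.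
Qed.

Lemma c2_half (r : nat) : (r < half_order)%N ->
  (half_order %| 4 * (c2 k r)%:Z - (r%:Z - 3))%Z /\ odd (c2 k r).
Proof.
move=> r_lt; rewrite /c2.
set g := fun r => _.
have [|dvd_c ->] := @antisymmetric_extension_half g (r%:Z - 3) r r_lt.
  (* Exact quotient by [h]: [4(12k+5) + 2 = 2h], [4(30k+13) + 3 = 5h] and [4(12k+6) - 2 = 2h]. *)
  apply/dvdzP; exists ((if odd r then 2 else 5) + 2 * (r./2)%:Z).
  rewrite -[in X in _ - (X - _)](odd_double_half r) /g /half_order.
  by case: (odd r); rewrite -muln2 !(PoszD, PoszM) /=; ring.
by split=> //; rewrite /g; clear; case: ifP => _; rewrite oddD oddM; lia.
Qed.

Lemma c3_half (r : nat) : (r < half_order)%N ->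
  (half_order %| 4 * (c3 k r)%:Z - (3 * r%:Z + 1))%Z /\ odd (c3 k r) = odd r./2.
Proof.
move=> r_lt; rewrite /c3.
set g := fun r => _.
have [|dvd_c ->] := @antisymmetric_extension_half g (3 * r%:Z + 1) r r_lt.
  (* Similarly [4(24k+12) - 4 = 4h], [4(30k+14) - 1 = 5h] and [4(12k+7) - 6 = 2h]. *)
  apply/dvdzP; exists ((if odd r then 4 else 5) + 2 * (r./2)%:Z).
  rewrite -[in X in _ - (_ * X + _)](odd_double_half r) /g /half_order.
  by case: (odd r); rewrite -muln2 !(PoszD, PoszM) /=; ring.
by split=> //; rewrite /g; clear; case: ifP => _; rewrite oddD oddM; lia.
Qed.

(** The sum lies between [-2] and [2h + 2], and [h >= 11] excludes [-h] and [3h]. Parities can then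
    be read off actual values of [r + q]. *)
Lemma small_multiple (r q : nat) (s : int) :
  (r < half_order)%N -> (q < half_order)%N ->
  (half_order %| r%:Z + q%:Z + s)%Z -> -2 <= s <= 4 ->
  [\/ r%:Z + q%:Z + s = 0, r%:Z + q%:Z + s = half_order |
      r%:Z + q%:Z + s = half_order.*2].
Proof.
move=> r_lt q_lt /dvdzP[u rqE] s_bd.
have h_ge : (11 <= half_order)%N by rewrite /half_order; lia.
have : (u == 0) || (u == 1) || (u == 2) by nia.
move=> /orP[/orP[]|] /eqP uE; move: rqE; rewrite uE => ->.
- by constructor 1; rewrite mul0r.
- by constructor 2; rewrite mul1r.
- by constructor 3; rewrite -mul2n PoszM.
Qed.

Lemma coprimez_half_order (a : int) : `|a|%N \in [:: 1; 2; 3]%N -> coprimez a half_order.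
Proof.
rewrite coprimezE !inE => /or3P[] /eqP->; rewrite ?coprime1n //.
- by rewrite coprime2n half_order_odd.
- by rewrite prime_coprime //= /half_order; lia.
Qed.

Lemma latin_c1 : latin_square (cyclic_array (sq_order k) (c1 k)).
Proof.
apply: latin_cyclic_array => z.
have n_gt0 : (0 < sq_order k)%N by rewrite sq_orderE; case: half_order half_order_odd.
have z_ge0 : (0 <= z %% sq_order k)%Z by apply: modz_ge0; rewrite lt0n_neq0.
exists `|(z %% sq_order k)%Z|%N.
  by rewrite -ltz_nat gez0_abs // ltz_pmod.
by rewrite /c1 gez0_abs // -eqz_mod_dvd modz_mod.
Qed.

Lemma latin_c2 : latin_square (cyclic_array (sq_order k) (c2 k)).
Proof.
apply: (@latin_antisymmetric _ half_order _ 1 (-3) (-2)) => //.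
- exact: sq_orderE.
- exact: half_order_odd.
- exact: antisymmetric_c2.
- exact: coprimez_half_order.
- by move=> r /c2_half[+ _]; rewrite mul1r.
- by move=> r q /c2_half[_ ->] /c2_half[_ ->].
Qed.

Lemma latin_c3 : latin_square (cyclic_array (sq_order k) (c3 k)).
Proof.
apply: (@latin_antisymmetric _ half_order _ 3 1 2) => //.
- exact: sq_orderE.
- exact: half_order_odd.
- exact: antisymmetric_c3.
- exact: coprimez_half_order.
- by move=> r /c3_half[].
move=> r q r_lt q_lt /(small_multiple r_lt q_lt) /(_ isT).
have [_ ->] := c3_half r_lt; have [_ ->] := c3_half q_lt.
(* If [r + q = h - 2 = 24k + 9], the halves sum to the even number [12k + 4]; if [r + q = 2h - 2],
   then [r = q]. *)
by move: r_lt q_lt; rewrite /half_order => r_lt q_lt []; lia.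
Qed.

Lemma nearly_orthogonal_c1_c2 :
  nearly_orthogonal (cyclic_array (sq_order k) (c1 k)) (cyclic_array (sq_order k) (c2 k)).
Proof.
apply: (@nearly_orthogonal_antisymmetric _ half_order _ _ (-3) (-3) 2) => //.
- exact: sq_orderE.
- exact: half_order_odd.
- exact: antisymmetric_c1.
- exact: antisymmetric_c2.
- exact: coprimez_half_order.
- move=> r /c2_half[+ _]; rewrite /c1.
  by rewrite (_ : _ * (_ - _) - _ = 4 * (c2 k r)%:Z - (r%:Z - 3)) //; ring.
move=> r q r_lt q_lt /(small_multiple r_lt q_lt) /(_ isT).
have [_ ->] := c2_half r_lt; have [_ ->] := c2_half q_lt.
rewrite /c1; move: r_lt q_lt; rewrite /half_order => r_lt q_lt.
by case: eqP => rq []; lia.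
Qed.

Lemma nearly_orthogonal_c1_c3 :
  nearly_orthogonal (cyclic_array (sq_order k) (c1 k)) (cyclic_array (sq_order k) (c3 k)).
Proof.
apply: (@nearly_orthogonal_antisymmetric _ half_order _ _ (-1) 1 (-2)) => //.
- exact: sq_orderE.
- exact: half_order_odd.
- exact: antisymmetric_c1.
- exact: antisymmetric_c3.
- exact: coprimez_half_order.
- move=> r /c3_half[+ _]; rewrite /c1.
  by rewrite (_ : _ * (_ - _) - _ = 4 * (c3 k r)%:Z - (3 * r%:Z + 1)) //; ring.
move=> r q r_lt q_lt /(small_multiple r_lt q_lt) /(_ isT).
have [_ ->] := c3_half r_lt; have [_ ->] := c3_half q_lt.
rewrite /c1; move: r_lt q_lt; rewrite /half_order => r_lt q_lt.
(* The sum [r + q] is [2] or [h + 2 = 24k + 13]. In the latter case [r] and [q] differ in parity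
   while their halves agree. *)
by case: eqP => rq []; lia.
Qed.

Lemma nearly_orthogonal_c2_c3 :
  nearly_orthogonal (cyclic_array (sq_order k) (c2 k)) (cyclic_array (sq_order k) (c3 k)).
Proof.
apply: (@nearly_orthogonal_antisymmetric _ half_order _ _ 2 4 4) => //.
- exact: sq_orderE.
- exact: half_order_odd.
- exact: antisymmetric_c2.
- exact: antisymmetric_c3.
- exact: coprimez_half_order.
- move=> r r_lt; have [dvd_c2 _] := c2_half r_lt; have [dvd_c3 _] := c3_half r_lt.
  have := rpredB dvd_c3 dvd_c2.
  by rewrite (_ : _ - _ = 4 * ((c3 k r)%:Z - (c2 k r)%:Z) - (2 * r%:Z + 4)) //; ring.
move=> r q r_lt q_lt /(small_multiple r_lt q_lt) /(_ isT).
have [_ ->] := c3_half r_lt; have [_ ->] := c3_half q_lt.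
have [_ ->] := c2_half r_lt; have [_ ->] := c2_half q_lt.
move: r_lt q_lt; rewrite /half_order => r_lt q_lt.
(* If [r + q = h - 4 = 24k + 7], the halves sum to the odd number [12k + 3]. Otherwise
   [r + q = 2h - 4], leaving only [h - 1], [h - 2] and [h - 3] as values. *)
by case: eqP => rq []; lia.
Qed.

End Construction.

Theorem theorem4 (k : nat) :
  let n := sq_order k in
  let L1 := cyclic_array n (c1 k) in
  let L2 := cyclic_array n (c2 k) in
  let L3 := cyclic_array n (c3 k) in
  #|[set L1; L2; L3]| = 3 /\ mutually_nearly_orthogonal [set L1; L2; L3].
Proof.
move=> n L1 L2 L3.
have NO12 : nearly_orthogonal L1 L2 := nearly_orthogonal_c1_c2 k.
have NO13 : nearly_orthogonal L1 L3 := nearly_orthogonal_c1_c3 k.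
have NO23 : nearly_orthogonal L2 L3 := nearly_orthogonal_c2_c3 k.
have n_gt1 : 1 < n by rewrite /n /sq_order addnC.
split.
  rewrite setUC cardsU1 cards2 !inE negb_or (nearly_orthogonal_neq n_gt1 NO12).
  rewrite eq_sym (nearly_orthogonal_neq n_gt1 NO13).
  by rewrite eq_sym (nearly_orthogonal_neq n_gt1 NO23).
split=> [L|L M].
  rewrite !inE => /orP[/orP[]|] /eqP->.
  - exact: latin_c1.
  - exact: latin_c2.
  - exact: latin_c3.
rewrite !inE => /orP[/orP[]|] /eqP-> /orP[/orP[]|] /eqP->; rewrite ?eqxx // => _.
all: exact: nearly_orthogonal_sym.
Qed.
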